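(* Let $r \ge 1$ be a real number. Then $$\psi(r)\leq X(r)+\sqrt{X(r)^2-1},\qquad\text{where}\quad X(r)=r+\sqrt{r^2-1}.$$
   Context: For a complex Hilbert space $H$ with inner product $\langle\cdot,\cdot\rangle$ and norm $\|\cdot\|$, $\mathcal{B}(H)$ denotes the algebra of bounded linear operators on $H$, with operator norm $\|A\|=\sup\{\|Ah\| : h\in H,\ \|h\|=1\}$. The numerical radius of $A\in\mathcal{B}(H)$ is $w(A)=\sup\{|\langle Ah,h\rangle| : h\in H,\ \|h\|=1\}$. For real $r\ge 1$, define $$\psi(r)=\sup\{\|A\| : A\in\mathcal{B}(H),\ A \text{ invertible},\ w(A)\leq r,\ w(A^{-1})\leq r\},$$ where the supremum is also taken over all complex Hilbert spaces $H$. *)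

(* Defs.v *)
From HB Require Import structures.
From mathcomp Require Import all_boot all_order all_algebra sesquilinear.
From mathcomp Require Import complex.
From mathcomp Require Import boolp classical_sets reals constructive_ereal ereal.
From mathcomp Require Import topology normedtype.

Set Implicit Arguments.
Unset Strict Implicit.
Unset Printing Implicit Defensive.

Import Order.TTheory GRing.Theory Num.Theory.
Import numFieldNormedType.Exports.

Local Open Scope classical_set_scope.
Local Open Scope ring_scope.
Local Open Scope complex_scope.

(* In a normed module over R[i] the norm [`|x|] is itself an element of R[i]
   (with zero imaginary part). The form [inner] is positive definite, linear in
   its first argument and conjugate-linear in the second. *)
HB.mixin Record NormedModule_isInnerProduct (R : realType) H
    of NormedModule R[i] H := {
  inner : {dot H for (@Num.conj R[i])};
  inner_normE : forall x : H, inner x x = `|x| ^+ 2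
}.

#[short(type="hilbertType")]
HB.structure Definition Hilbert (R : realType) :=
  {H of CompleteNormedModule R[i] H & NormedModule_isInnerProduct R H}.

Section operators.
Variables (R : realType) (H : hilbertType R).
Implicit Types A B : {linear H -> H}.

Definition bounded_operator A : Prop :=
  exists M : R, forall h : H, `|A h| <= M%:C * `|h|.

Definition unit_sphere : set H := [set h | `|h| = 1].

(* On the zero space the unit sphere is empty, and [sup set0 = 0]. *)
Definition opnorm A : R := sup [set complex.Re `|A h| | h in unit_sphere].

Definition numerical_radius A : R :=
  sup [set complex.Re `|inner (A h) h| | h in unit_sphere].

Definition inverse_operator A B : Prop :=
  [/\ bounded_operator B, cancel A B & cancel B A].

End operators.

(* [B] stands for the inverse of [A], which is unique. *)
Definition psi (R : realType) (r : R) : \bar R :=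
  ereal_sup [set y : \bar R | exists (H : hilbertType R) (A B : {linear H -> H}),
    [/\ bounded_operator A, inverse_operator A B,
        numerical_radius A <= r, numerical_radius B <= r
      & y = (opnorm A)%:E]].

Definition X (R : realType) (r : R) : R := r + Num.sqrt (r ^+ 2 - 1).

(* Main.v *)
Require Import Defs.
From mathcomp Require Import all_boot all_order all_algebra.
From mathcomp Require Import reals constructive_ereal.
From mathcomp Require Import cyclic separable cyclotomic complex.
From mathcomp Require Import classical_sets ereal normedtype.
From mathcomp Require Import ring lra.

Set Implicit Arguments.
Unset Strict Implicit.
Unset Printing Implicit Defensive.

Import Order.TTheory GRing.Theory Num.Theory.

Local Open Scope ring_scope.

(** For a unit vector h put u_j = A^j h / |A^j h| for j in Z, so that
    A u_j = s_j u_(j+1) and A^-1 u_(j+1) = s_j^-1 u_j.  Averaging <T y, y> over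
    y = sum_j zeta^j x_j, with zeta running through roots of unity, turns
    w(T) <= r into |sum_j <T x_j, x_(j+1)>| <= r sum_j |x_j|^2.  Applied to
    x_j = a_j u_j, with T = A and (for the reversed chain) T = A^-1, this gives
      sum_j a_j a_(j+1) (s_j + 1/s_j) <= 2 r sum_j a_j^2.
    Every s_j + 1/s_j is at least 2; let 2t = s_0 + 1/s_0, where s_0 = |A h|.
    If t > 1, taking a_j = t^-|j| on both sides of the bond (0, 1) (the bound
    state of the perturbed discrete Laplacian) yields t + 1/t <= 2r, hence
    t <= X(r), and s_0 + 1/s_0 = 2t <= 2 X(r) then bounds s_0. *)

(** * Roots of unity *)

Lemma closed_prim_root_exists (C : numClosedFieldType) n :
  (0 < n)%N -> exists z : C, n.-primitive_root z.
Proof.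
move=> n_gt0; pose p : {poly C} := 'X^n - 1.
have [rs] := closed_field_poly_normal p.
rewrite (monicP _) ?monicXnsubC // scale1r => Dp.
have rn1 : all n.-unity_root rs.
  by apply/allP => z; rewrite -root_prod_XsubC -Dp.
have sz_rs : (n < (size rs).+1)%N.
  by rewrite -(size_prod_XsubC rs id) -Dp size_XnsubC.
have [|z] := hasP (has_prim_root n_gt0 rn1 _ sz_rs); last by exists z.
by rewrite -separable_prod_XsubC -Dp separable_Xn_sub_1 // pnatr_eq0 -lt0n.
Qed.

Lemma prim_root_norm (C : numClosedFieldType) m (z : C) :
  m.-primitive_root z -> `|z| = 1.
Proof.
move=> pz; apply/eqP; rewrite -(@pexpr_eq1 _ _ m) ?(prim_order_gt0 pz) //.
by rewrite -normrX (prim_expr_order pz) normr1.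
Qed.

(** Conjugation inverts [z], so this is a geometric sum whose ratio is an [m]-th root of unity,
    equal to 1 only if [a = b]. *)
Lemma prim_root_orthogonality (C : numClosedFieldType) m (z : C) a b :
    m.-primitive_root z -> (a < m)%N -> (b < m)%N ->
  \sum_(k < m) (z ^+ a * (z ^+ b)^*) ^+ k = (a == b)%:R * m%:R.
Proof.
move=> pz am bm; have z1 := prim_root_norm pz.
have z0 : z != 0 by rewrite -normr_gt0 z1 ltr01.
have zV : z^* = z^-1 by rewrite invC_norm z1 expr1n invr1 mul1r.
rewrite rmorphXn /= zV; set u := _ * _.
have u1 : (u == 1) = (a == b).
  rewrite /u exprVn -(inj_eq (mulIf (expf_neq0 b z0))) mulfVK ?expf_neq0 // mul1r.
  by rewrite (eq_prim_root_expr pz) !modn_small.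
have [ab|ab] := eqVneq a b.
  have -> : u = 1 by apply/eqP; rewrite u1 ab.
  under eq_bigr do rewrite expr1n.
  by rewrite sumr_const card_ord mul1r.
have um : u ^+ m = 1.
  rewrite /u exprMn exprVn exprVn -!exprM ![(_ * m)%N]mulnC !exprM.
  by rewrite (prim_expr_order pz) !expr1n invr1 mulr1.
have := subrX1 u m; rewrite um subrr => /esym/eqP.
by rewrite mulf_eq0 subr_eq0 u1 (negPf ab) /= mul0r => /eqP.
Qed.

(** * Chain inequalities for a sesquilinear form *)

Section Chains.
Variables (C : numClosedFieldType) (U : lmodType C).
Variable form : {dot U for (@Num.conj C)}.
Implicit Type T : {linear U -> U}.

(** After expansion the pair [(i, j)] carries the phase [z ^ (i + d - j)], so orthogonality keeps
    only [j = i + d]. The bound [n + d <= m] rules out wrap-around modulo [m]. *)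
Lemma root_average T m (z : C) (x : nat -> U) n d :
    m.-primitive_root z -> (n + d <= m)%N ->
  \sum_(k < m) z ^+ (d * k) * form (T (\sum_(i < n) z ^+ (i * k) *: x i))
                                 (\sum_(i < n) z ^+ (i * k) *: x i)
  = m%:R * \sum_(i < n) \sum_(j < n | (j == i + d :> nat)%N) form (T (x i)) (x j).
Proof.
move=> pz ndm.
have term (k : 'I_m) (i j : 'I_n) :
    z ^+ (d * k) * form (T (z ^+ (i * k) *: x i)) (z ^+ (j * k) *: x j) =
    (z ^+ (i + d) * (z ^+ j)^* ) ^+ k * form (T (x i)) (x j).
  rewrite (linearZ_LR T) (linearZl_LR form) (linearZr_LR form) /=.
  rewrite exprMn -rmorphXn -!exprM mulnDl exprD !mulrA; congr (_ * _ * _).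
  exact: mulrC.
transitivity (\sum_(i < n) \sum_(j < n) \sum_(k < m)
    (z ^+ (i + d) * (z ^+ j)^* ) ^+ k * form (T (x i)) (x j)).
  under [RHS]eq_bigr do rewrite exchange_big /=.
  rewrite [RHS]exchange_big /=; apply: eq_bigr => k _.
  rewrite (linear_sum T) (linear_sumlz form) mulr_sumr; apply: eq_bigr => i _ /=.
  rewrite (linear_sumr form) mulr_sumr; apply: eq_bigr => j _; exact: term.
rewrite mulr_sumr; apply: eq_bigr => i _.
rewrite mulr_sumr [RHS]big_mkcond; apply: eq_bigr => j _ /=.
rewrite -mulr_suml prim_root_orthogonality //.
- by rewrite eq_sym; case: eqP => _; rewrite ?mul1r // mul0r mul0r.
- by apply: leq_trans ndm; rewrite ltn_add2r.
- by apply: leq_trans (ltn_ord j) (leq_trans (leq_addr _ _) ndm).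
Qed.

(** Averaging with shift [d = 1] produces the left side; averaging [idfun] with [d = 0] produces the
    right side. The hypothesis on [T] compares the two averages term by term. *)
Lemma chain_sum_le T (w : C) (x : nat -> U) n :
    (forall y, `|form (T y) y| <= w * form y y) ->
  `|\sum_(i < n) form (T (x i)) (x i.+1)| <= w * \sum_(i < n.+1) form (x i) (x i).
Proof.
(* Order [n.+2] leaves room for [n.+1] vectors shifted by one. *)
move=> wT; have [z pz] := @closed_prim_root_exists C n.+2 isT.
have m_gt0 : 0 < n.+2%:R :> C by rewrite ltr0n.
have := @root_average T _ z x n.+1 1 pz; rewrite addn1 => /(_ (leqnn _)) avT.
have := @root_average idfun _ z x n.+1 0 pz; rewrite addn0 => /(_ (leqnSn _)) avI.
have eT : \sum_(i < n.+1) \sum_(j < n.+1 | (j == i + 1 :> nat)%N)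
    form (T (x i)) (x j) = \sum_(i < n) form (T (x i)) (x i.+1).
  rewrite big_ord_recr /= [X in _ + X]big1 ?addr0; last first.
    by move=> j /eqP jn; have := ltn_ord j; rewrite jn addn1 ltnn.
  apply: eq_bigr => i _; have ltin : (i.+1 < n.+1)%N by rewrite ltnS.
  by rewrite (big_pred1 (Ordinal ltin)) // => j; rewrite /= addn1.
have eI : \sum_(i < n.+1) \sum_(j < n.+1 | (j == i + 0 :> nat)%N)
    form (idfun (x i)) (x j) = \sum_(i < n.+1) form (x i) (x i).
  by apply: eq_bigr => i _; rewrite (big_pred1 i) // => j; rewrite /= addn0.
rewrite -(ler_pM2l m_gt0) mulrCA -eI -avI -(ger0_norm (ltW m_gt0)) -normrM -eT -avT.
apply: le_trans (ler_norm_sum _ _ _) _.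
rewrite mulr_sumr; apply: ler_sum => k _.
rewrite mul0n expr0 mul1r normrM.
rewrite normrX (prim_root_norm pz) expr1n mul1r; exact: wT.
Qed.

Lemma orbit_chain_le (A B : {linear U -> U}) (w : C) (u : nat -> U) (s a : nat -> C) n :
    (forall y, `|form (A y) y| <= w * form y y) ->
    (forall y, `|form (B y) y| <= w * form y y) ->
    (forall i, form (u i) (u i) = 1) -> (forall i, 0 < s i) -> (forall i, 0 <= a i) ->
    (forall i, A (u i) = s i *: u i.+1) -> (forall i, B (u i.+1) = (s i)^-1 *: u i) ->
  \sum_(i < n) a i * a i.+1 * (s i + (s i)^-1) <= 2 * w * \sum_(i < n.+1) a i ^+ 2.
Proof.
move=> wA wB u1 s_gt0 a_ge0 Au Bu.
pose x i := a i *: u i.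
have norm_x i : form (x i) (x i) = a i ^+ 2.
  by rewrite (linearZl_LR form) (linearZr_LR form) /= u1 mulr1 (geC0_conj (a_ge0 i)).
have pairA i : form (A (x i)) (x i.+1) = a i * a i.+1 * s i.
  rewrite (linearZ_LR A) Au !(linearZl_LR form) (linearZr_LR form) /= u1 mulr1.
  by rewrite (geC0_conj (a_ge0 _)) mulrAC mulrA.
have pairB i : form (B (x i.+1)) (x i) = a i * a i.+1 * (s i)^-1.
  rewrite (linearZ_LR B) Bu !(linearZl_LR form) (linearZr_LR form) /= u1 mulr1.
  by rewrite (geC0_conj (a_ge0 _)) mulrA mulrC mulrA.
have := chain_sum_le x n wA; have := chain_sum_le (fun i => x (n - i)%N) n wB.
have -> : \sum_(i < n) form (B (x (n - i)%N)) (x (n - i.+1)%N)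
    = \sum_(i < n) a i * a i.+1 * (s i)^-1.
  rewrite (reindex_inj rev_ord_inj); apply: eq_bigr => i _ /=.
  by rewrite subnSK // !subKn // ?pairB // ltnW.
have -> : \sum_(i < n.+1) form (x (n - i)%N) (x (n - i)%N) = \sum_(i < n.+1) a i ^+ 2.
  rewrite (reindex_inj rev_ord_inj); apply: eq_bigr => i _ /=.
  by rewrite subSS subKn ?norm_x // -ltnS.
have -> : \sum_(i < n) form (A (x i)) (x i.+1) = \sum_(i < n) a i * a i.+1 * s i.
  by apply: eq_bigr => i _; exact: pairA.
have -> : \sum_(i < n.+1) form (x i) (x i) = \sum_(i < n.+1) a i ^+ 2.
  by apply: eq_bigr => i _; exact: norm_x.
have s_ge0 i : 0 <= s i by exact: ltW.
rewrite !ger0_norm; first last.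
- by apply: sumr_ge0 => i _; rewrite !mulr_ge0 ?invr_ge0.
- by apply: sumr_ge0 => i _; rewrite !mulr_ge0.
move=> leB leA; under eq_bigr do rewrite mulrDr.
by rewrite big_split /= -mulrA mulr2n mulrDl !mul1r lerD.
Qed.

End Chains.

(** * The geometric test sequence and its limit *)

(** The central bond [N] contributes exactly [2 * t]. The [N] bonds on either side are estimated by
    [s i + (s i)^-1 >= 2], and by symmetry a common factor 2 cancels. *)
Lemma two_sided_geometric_le (C : numFieldType) (z w t : C) (s : nat -> C) N :
    0 <= z -> (forall i, 0 < s i) -> s N + (s N)^-1 = 2 * t ->
    (forall a : nat -> C, (forall i, 0 <= a i) ->
      \sum_(i < N + N.+1) a i * a i.+1 * (s i + (s i)^-1)
        <= 2 * w * \sum_(i < (N + N.+1).+1) a i ^+ 2) ->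
  t + 2 * z * \sum_(i < N) (z ^+ 2) ^+ i <= 2 * w * \sum_(i < N.+1) (z ^+ 2) ^+ i.
Proof.
move=> z_ge0 s_gt0 sN chain.
(* By truncated subtraction the exponent is the distance of i to {N, N.+1}. *)
pose a i := z ^+ ((N - i) + (i - N.+1)).
have {chain} := chain a (fun i => exprn_ge0 _ z_ge0).
have s_ge2 i : 2 <= s i + (s i)^-1.
  rewrite -subr_ge0.
  have -> : s i + (s i)^-1 - 2 = (s i - 1) ^+ 2 / s i.
    by field; rewrite gt_eqF.
  apply: divr_ge0; last exact: ltW.
  (* In [C] a square is nonnegative only when its root is real, which positivity of [s i]
     ensures. *)
  rewrite -realEsqr; apply: rpredB; last exact: rpred1.
  exact: gtr0_real.
have al i : (i <= N)%N -> a i = z ^+ (N - i).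
  by move=> iN; rewrite /a (eqP (leqW iN : i <= N.+1)%N) addn0.
have ar i : a (N.+1 + i)%N = z ^+ i.
  by rewrite /a addKn (eqP (leq_trans (leqnSn N) (leq_addr _ _) : N <= N.+1 + i)%N).
have -> : \sum_(i < (N + N.+1).+1) a i ^+ 2 = 2 * \sum_(i < N.+1) (z ^+ 2) ^+ i.
  rewrite -addSn big_split_ord /= mulr2n mulrDl mul1r; congr (_ + _).
    rewrite (reindex_inj rev_ord_inj); apply: eq_bigr => i _ /=.
    rewrite subSS al ?leq_subr // subKn; last by rewrite -ltnS.
    by rewrite -exprM mulnC exprM.
  by apply: eq_bigr => i _; rewrite ar exprAC.
rewrite big_split_ord big_ord_recl /= addn0 sN => H.
have aN : a N * a N.+1 = 1.
  by rewrite al // subnn -[N.+1]addn0 ar mulr1.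
(* On both sides, neighbouring weights at distances [i] and [i.+1] have product [z ^ (2i + 1)]. *)
have step i (p q : C) : p * q = z * (z ^+ 2) ^+ i -> 0 <= p * q ->
    forall j, 2 * z * (z ^+ 2) ^+ i <= p * q * (s j + (s j)^-1).
  by move=> pq pq_ge0 j; rewrite -mulrA -pq mulrC ler_wpM2l.
have left : 2 * z * \sum_(i < N) (z ^+ 2) ^+ i
    <= \sum_(i < N) a i * a i.+1 * (s i + (s i)^-1).
  rewrite [leRHS](reindex_inj rev_ord_inj) mulr_sumr; apply: ler_sum => i _ /=.
  apply: step; last by rewrite mulr_ge0 ?exprn_ge0.
  rewrite subnSK // !al ?leq_subr // !subKn // ?(ltnW (ltn_ord i)) //.
  by rewrite exprS -exprM mulnC exprM -mulrA -expr2 exprAC.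
have right : 2 * z * \sum_(i < N) (z ^+ 2) ^+ i
    <= \sum_(i < N) a (N + lift ord0 i)%N * a (N + lift ord0 i).+1 *
         (s (N + lift ord0 i)%N + (s (N + lift ord0 i)%N)^-1).
  rewrite mulr_sumr; apply: ler_sum => i _ /=.
  apply: step; last by rewrite mulr_ge0 ?exprn_ge0.
  rewrite /bump leq0n add1n -addSnnS -addnS !ar exprS mulrCA -expr2.
  by rewrite exprAC.
have := le_trans (lerD left (lerD (lexx _) right)) H.
rewrite aN mul1r => {}H; rewrite -(ler_pM2l (ltr0n C 2)).
have -> : 2 * (2 * w * \sum_(i < N.+1) (z ^+ 2) ^+ i)
  = 2 * w * (2 * \sum_(i < N.+1) (z ^+ 2) ^+ i) by ring.
by apply: le_trans H; rewrite le_eqVlt; apply/predU1P; left; ring.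
Qed.

Lemma Bernoulli_ineq (R : numDomainType) (x : R) n :
  0 <= x -> 1 + n%:R * x <= (1 + x) ^+ n.
Proof.
move=> x_ge0; elim: n => [|n IHn]; first by rewrite mul0r addr0.
rewrite exprS; apply: le_trans (ler_wpM2l _ IHn); last by rewrite addr_ge0.
rewrite -subr_ge0 -natr1.
have -> : (1 + x) * (1 + n%:R * x) - (1 + (n%:R + 1) * x) = n%:R * x ^+ 2 by ring.
by rewrite mulr_ge0 // exprn_ge0.
Qed.

(** Multiplying by [1 - q], with [q = t^-2], sums both series and leaves
    [t + t^-1 - 2 * r <= 2 * q ^ N]. Since [q < 1], a positive left side fails for large [N]. *)
Lemma geometric_chain_bound (R : archiRealFieldType) (r t : R) :
    0 <= r -> 1 < t ->
    (forall N, t + 2 * t^-1 * \sum_(i < N) (t^-1 ^+ 2) ^+ i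
       <= 2 * r * \sum_(i < N.+1) (t^-1 ^+ 2) ^+ i) ->
  t + t^-1 <= 2 * r.
Proof.
move=> r_ge0 t_gt1 chain; rewrite leNgt -subr_gt0; apply/negP => gap.
have t_gt0 : 0 < t by exact: lt_trans t_gt1.
have t0 : t != 0 by rewrite gt_eqF.
set z := t^-1 in gap chain *.
have z_gt0 : 0 < z by rewrite invr_gt0.
have z_lt1 : z < 1 by rewrite invf_lt1.
set q := z ^+ 2 in chain.
have tz : t * z = 1 by rewrite mulfV.
have q_ge0 : 0 <= q by rewrite exprn_ge0 ?ltW.
have gapN N : (t + z - 2 * r) * (t ^+ 2) ^+ N <= 2.
  have qN : q ^+ N * (t ^+ 2) ^+ N = 1.
    by rewrite -exprMn /q -exprMn mulrC tz !expr1n.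
  have q_lt1 : q < 1 by rewrite /q expr_lt1 // ltW.
  have geo n : (1 - q) * (\sum_(i < n) q ^+ i) = 1 - q ^+ n.
    by rewrite -[LHS]opprK -mulNr opprB -subrX1 opprB.
  suff le_q : t + z - 2 * r <= 2 * q ^+ N.
    apply: le_trans (ler_wpM2r _ le_q) _; first by rewrite !exprn_ge0 // ltW.
    by rewrite -mulrA qN mulr1.
  have Q_ge0 : 0 <= q ^+ N by rewrite exprn_ge0.
  have q1_ge0 : 0 <= 1 - q by rewrite subr_ge0 ltW.
  have := ler_wpM2l q1_ge0 (chain N).
  have -> : (1 - q) * (t + 2 * z * \sum_(i < N) q ^+ i)
      = t - t * z * z + 2 * z * ((1 - q) * \sum_(i < N) q ^+ i).
    by rewrite /q; ring.
  rewrite [leRHS]mulrCA !geo tz mul1r exprS => le_chain.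
  have zQ : z * q ^+ N <= q ^+ N by rewrite ler_piMl // ltW.
  have rQ : 0 <= r * (q * q ^+ N) by exact: mulr_ge0 r_ge0 (mulr_ge0 q_ge0 Q_ge0).
  lra.
have d_gt0 : 0 < t ^+ 2 - 1 by rewrite subr_gt0 exprn_egt1.
set e := t + z - 2 * r in gap gapN.
have ed_gt0 : 0 < e * (t ^+ 2 - 1) by rewrite mulr_gt0.
(* This [N] makes [e * N * (t ^ 2 - 1)] exceed 2, which by Bernoulli contradicts [gapN]. *)
have := archi_boundP (_ : 0 <= 2 / (e * (t ^+ 2 - 1))).
rewrite divr_ge0 ?ltW // => /(_ isT); set N := Num.bound _.
rewrite ltr_pdivrMr // => ltN; have := gapN N.
rewrite leNgt => /negP; apply; apply: lt_le_trans ltN _.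
have := ler_wpM2l (ltW gap) (Bernoulli_ineq N (ltW d_gt0)).
rewrite [1 + (_ - 1)]addrC subrK => bern; apply: le_trans _ bern.
by rewrite [leRHS]mulrDr mulr1 mulrCA lerDr ltW.
Qed.

(** Multiplied by [y], the hypothesis reads [(y - x) ^ 2 <= x ^ 2 - 1]. *)
Lemma le_add_sqrt (R : rcfType) (x y : R) :
  0 < y -> y + y^-1 <= 2 * x -> y <= x + Num.sqrt (x ^+ 2 - 1).
Proof.
move=> y_gt0 yx; rewrite -lerBlDl; apply: le_trans (ler_norm _) _.
rewrite -sqrtr_sqr ler_wsqrtr // -subr_ge0.
have -> : x ^+ 2 - 1 - (y - x) ^+ 2 = y * (2 * x - (y + y^-1)).
  by field; rewrite gt_eqF.
by rewrite mulr_ge0 ?subr_ge0 // ltW.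
Qed.

Local Open Scope complex_scope.

(** * Operators on a Hilbert space *)

Section HilbertOperators.
Variables (R : realType) (H : hilbertType R).
Implicit Types (A B : {linear H -> H}) (h y : H).

(** Cauchy-Schwarz: removing the projection [d *: h] from [x] leaves squared norm [|x|^2 - |d|^2],
    which is nonnegative. *)
Lemma inner_le_norm (x h : H) : `|h| = 1 -> `|inner x h| <= `|x|.
Proof.
move=> h1; set d := inner x h.
have hh : inner h h = 1 by rewrite inner_normE h1 expr1n.
have := dnorm_ge0 (@inner R H) (x - d *: h).
rewrite (linearBl (@inner R H)) !(linearBr (@inner R H)).
rewrite !(linearZr_LR (@inner R H)) !(linearZl_LR (@inner R H)) /= hh -/d.
rewrite (hermC (@inner R H) h x) /= -/d expr0 mul1r.
rewrite mulr1 opprB addrA mulrC subrK inner_normE -normCK subr_ge0.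
by rewrite ler_sqr ?nnegrE.
Qed.

Lemma numerical_radiusP A (r : R) :
    bounded_operator A -> numerical_radius A <= r ->
  forall y, `|inner (A y) y| <= r%:C * inner y y.
Proof.
move=> [M AM] wA y.
have [->|y0] := eqVneq y 0.
  by rewrite !(linear0r (@inner R H)) normr0 mulr0.
have ny0 : `|y| != 0 by rewrite normr_eq0.
have [h h1 yE] : exists2 h : H, `|h| = 1 & y = `|y| *: h.
  exists (`|y|^-1 *: y); last by rewrite scalerA mulfV // scale1r.
  by rewrite normrZ normfV normr_id mulVf.
have Re_norm (c : R[i]) : (complex.Re `|c|)%:C = `|c| by rewrite RRe_real // normr_real.
have ub : complex.Re `|inner (A h) h| <= numerical_radius A.
  (* Boundedness of [A] gives the set an upper bound, so that its [sup] really dominates it. *)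
  apply: ub_le_sup; last by exists h.
  exists (complex.Re M%:C) => _ [k k1 <-].
  have := le_trans (inner_le_norm (A k) k1) (AM k).
  by rewrite k1 mulr1 -Re_norm lecR.
rewrite yE (linearZ_LR A) !(linearZl_LR (@inner R H)) !(linearZr_LR (@inner R H)) /=.
rewrite inner_normE h1 expr1n mulr1 !normrM (norm_conjC `|y|) normr_id.
rewrite (geC0_conj (normr_ge0 y)) -Re_norm mulrA [leRHS]mulrC ler_wpM2l ?mulr_ge0 //.
by rewrite lecR (le_trans ub).
Qed.

(** [le_add_sqrt] is used twice: first to reduce the claim to [t <= X r], then to reduce that to
    [t + t^-1 <= 2 * r]. *)
Lemma norm_unit_le A B (r : R) h :
    1 <= r -> cancel A B -> cancel B A ->
    (forall y, `|inner (A y) y| <= r%:C * inner y y) ->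
    (forall y, `|inner (B y) y| <= r%:C * inner y y) ->
  `|h| = 1 -> complex.Re `|A h| <= X r + Num.sqrt (X r ^+ 2 - 1).
Proof.
move=> r_ge1 AK BK wA wB h1.
have r_ge0 : 0 <= r by exact: le_trans r_ge1.
have inj0 (T T' : {linear H -> H}) : cancel T T' -> forall y : H, y != 0 -> T y != 0.
  by move=> TK y; apply: contraNneq => Ty; rewrite -(TK y) Ty (linear0 T').
have Re_norm (y : H) : (complex.Re `|y|)%:C = `|y| by rewrite RRe_real // normr_real.
set sh := complex.Re `|A h|; set t := (sh + sh^-1) / 2.
have h0 : h != 0 by rewrite -normr_gt0 h1.
have sh_gt0 : 0 < sh by rewrite -ltcR Re_norm normr_gt0 (inj0 A B).
apply: le_add_sqrt => //.
have -> : sh + sh^-1 = 2 * t by rewrite /t mulrC divfK.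
rewrite ler_pM2l //.
have X_ge1 : 1 <= X r by rewrite /X (le_trans r_ge1) // lerDl sqrtr_ge0.
(* Only [1 < t] makes the weights [t^-1 ^ i] decay. *)
have [t_le1|t_gt1] := leP t 1; first exact: le_trans X_ge1.
apply: le_add_sqrt; first exact: lt_trans t_gt1.
apply: geometric_chain_bound => // N.
set z := t^-1; have z_ge0 : 0 <= z by rewrite invr_ge0 ltW // (lt_trans _ t_gt1).
(* A window of the two-sided orbit, indexed by [nat]: [v i] is the power [i - N] of [A] applied to
   [h], so [h] sits at index [N] and [s N] is [|A h|]. *)
pose v i := iter i A (iter N B h).
have v0 i : v i != 0.
  elim: i => [|i]; last exact: inj0.
  by rewrite /v /=; elim: (N) => [|n] //; exact: inj0.
have vN : v N = h.
  by rewrite /v; elim: N {v v0} => //= n IHn; rewrite -iterS iterSr BK.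
pose nv i := `|v i|.
have nv_gt0 i : 0 < nv i by rewrite normr_gt0.
pose s i := nv i.+1 / nv i.
pose u i := (nv i)^-1 *: v i.
have u1 i : inner (u i) (u i) = 1.
  by rewrite inner_normE normrZ normfV (ger0_norm (ltW (nv_gt0 i))) mulVf ?expr1n // gt_eqF.
have s_gt0 i : 0 < s i by rewrite divr_gt0.
have Au i : A (u i) = s i *: u i.+1.
  by rewrite (linearZ_LR A) scalerA /s mulrAC mulfV ?mul1r // gt_eqF.
have Bu i : B (u i.+1) = (s i)^-1 *: u i.
  rewrite (linearZ_LR B) [v i.+1]/= AK scalerA /s invf_div mulrAC.
  by rewrite mulfV ?mul1r // gt_eqF.
have sN : s N + (s N)^-1 = 2 * t%:C.
  have -> : s N = sh%:C by rewrite /s /nv /= -/(v N) vN h1 divr1 /sh Re_norm.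
  by rewrite -fmorphV -rmorphD -(rmorph_nat (real_complex R)) -rmorphM /t mulrC divfK.
have chain (a : nat -> R[i]) : (forall i, 0 <= a i) ->
    \sum_(i < N + N.+1) a i * a i.+1 * (s i + (s i)^-1)
      <= 2 * r%:C * \sum_(i < (N + N.+1).+1) a i ^+ 2.
  move=> a_ge0; exact: (orbit_chain_le _ wA wB).
have := two_sided_geometric_le (_ : 0 <= z%:C) s_gt0 sN chain.
rewrite ler0c => /(_ z_ge0).
(* The real goal is embedded in [R[i]], where the chain inequality was obtained. *)
rewrite -lecR !(rmorphD, rmorphM, rmorph_sum, rmorph_nat) /=.
under eq_bigr do rewrite -!rmorphXn.
under [X in _ <= _ * X -> _]eq_bigr do rewrite -!rmorphXn.
by [].
Qed.

End HilbertOperators.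

Theorem theorem1p1 (R : realType) (r : R) (hr : 1 <= r) :
  (psi r <= (X r + Num.sqrt (X r ^+ 2 - 1))%:E)%E.
Proof.
have X_ge1 : 1 <= X r by rewrite /X (le_trans hr) // lerDl sqrtr_ge0.
apply: ge_ereal_sup => _ [H [A [B [bA [bB AK BK] wA wB ->]]]].
rewrite lee_fin /opnorm; set E := (X in sup X).
(* On the zero space [sup] takes the value 0, so nonnegativity of the bound suffices. *)
have [->|E0] := eqVneq E set0.
  by rewrite sup0 addr_ge0 ?sqrtr_ge0 // (le_trans ler01).
apply: ge_sup; first exact/set0P.
move=> _ [h h1 <-].
exact: (norm_unit_le hr AK BK (numerical_radiusP bA wA) (numerical_radiusP bB wB)).
Qed.
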